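(* Let $L,M,N$ be positive integers and let $g:=\{g_l\}_{l\in\mathbb{N}_L}$ and $h:=\{h_l\}_{l\in\mathbb{N}_L}$ be families in $\ell^2(\mathbb{Z}\times\mathbb{Z},\mathbb{R})$ such that $\mathcal{G}(g,L,M,N)$ is a frame for $\ell^2(\mathbb{Z}\times\mathbb{Z},\mathbb{H})$ with frame bounds $A\le B$, and suppose that $$R:=M^2\max_{k\in\mathbb{N}_N^2}\sum_{p\in\mathbb{Z}^2}\left|\left(\sum_{l\in\mathbb{N}_L}\mathcal{M}_{g_l-h_l}(k)\mathcal{M}_{g_l-h_l}^t(k)\right)_{0_{\mathbb{Z}^2},p}\right|<A.$$ Then $\mathcal{G}(h,L,M,N)$ is a frame for $\ell^2(\mathbb{Z}\times\mathbb{Z},\mathbb{H})$ with frame bounds $$A\left(1-\sqrt{\frac RA}\right)^2,\qquad B\left(1+\sqrt{\frac RB}\right)^2.$$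
   Context: $\mathbb{H}$ is the algebra of real quaternions with imaginary units $i,j,ij$. For a positive integer $K$, $\mathbb{N}_K:=\{0,1,\dots,K-1\}$. $\ell^2(\mathbb{Z}\times\mathbb{Z},\mathbb{H})$ is the right quaternionic Hilbert space of functions $f:\mathbb{Z}^2\to\mathbb{H}$ with $\sum_{k\in\mathbb{Z}^2}|f(k)|^2<\infty$, with inner product $\langle f,g\rangle=\sum_{k\in\mathbb{Z}^2}\overline{f(k)}\,g(k)$; $\ell^2(\mathbb{Z}\times\mathbb{Z},\mathbb{R})$ is the subset of real-valued ones. For $n\in\mathbb{Z}^2$, $(T_{nN}f)(k)=f(k-nN)$ where $nN=(n_1N,n_2N)$. For $m=(m_1,m_2)\in\mathbb{N}_M^2$, $(E_{\frac mM}f)(k)=e^{2\pi i\frac{m_1}{M}k_1}f(k)e^{2\pi j\frac{m_2}{M}k_2}$, $k=(k_1,k_2)\in\mathbb{Z}^2$. The Gabor system is $\mathcal{G}(g,L,M,N):=\{E_{\frac mM}T_{nN}g_l\}_{l\in\mathbb{N}_L,\,m\in\mathbb{N}_M^2,\,n\in\mathbb{Z}^2}$. It is a frame with frame bounds $A\le B$ (where $0<A\le B<\infty$) if for all $f\in\ell^2(\mathbb{Z}\times\mathbb{Z},\mathbb{H})$: $A\|f\|^2\le\sum_{l\in\mathbb{N}_L}\sum_{n\in\mathbb{Z}^2}\sum_{m\in\mathbb{N}_M^2}|\langle E_{\frac mM}T_{nN}g_l,f\rangle|^2\le B\|f\|^2$. For $u\in\ell^2(\mathbb{Z}\times\mathbb{Z},\mathbb{H})$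 and $k\in\mathbb{Z}^2$, $\mathcal{M}_u(k)$ is the matrix indexed by $\mathbb{Z}^2\times\mathbb{Z}^2$ with entries $(\mathcal{M}_u(k))_{p,n}=u(k+pM-nN)$, $p,n\in\mathbb{Z}^2$; $^t$ denotes transpose, so for real-valued $u$, $(\mathcal{M}_u(k)\mathcal{M}_u^t(k))_{0_{\mathbb{Z}^2},p}=\sum_{n\in\mathbb{Z}^2}u(k-nN)u(k+pM-nN)$. $0_{\mathbb{Z}^2}=(0,0)$. *)

(* Defs.v *)
From HB Require Import structures.
From mathcomp Require Import all_boot all_order all_algebra.
From mathcomp Require Import ring.
From mathcomp Require Import all_classical all_reals all_analysis.

Set Implicit Arguments.
Unset Strict Implicit.
Unset Printing Implicit Defensive.

Import Order.TTheory GRing.Theory Num.Theory.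
Local Open Scope classical_set_scope.
Local Open Scope ring_scope.

(* [Quat a b c d] is a + b i + c j + d ij. *)
Record quat (R : Type) := Quat { q_1 : R; q_i : R; q_j : R; q_ij : R }.

Section QuatRing.
Variable R : realType.
Implicit Types x y z : quat R.

Definition quat_to_prod x : R * R * R * R := (q_1 x, q_i x, q_j x, q_ij x).
Definition prod_to_quat (t : R * R * R * R) : quat R :=
  Quat t.1.1.1 t.1.1.2 t.1.2 t.2.
Lemma quat_to_prodK : cancel quat_to_prod prod_to_quat. Proof. by case. Qed.
HB.instance Definition _ := Choice.copy (quat R) (can_type quat_to_prodK).

Definition qzero : quat R := Quat 0 0 0 0.
Definition qone : quat R := Quat 1 0 0 0.
Definition qopp x : quat R := Quat (- q_1 x) (- q_i x) (- q_j x) (- q_ij x).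
Definition qadd x y : quat R :=
  Quat (q_1 x + q_1 y) (q_i x + q_i y) (q_j x + q_j y) (q_ij x + q_ij y).
Definition qmul x y : quat R :=
  Quat (q_1 x * q_1 y - q_i x * q_i y - q_j x * q_j y - q_ij x * q_ij y)
       (q_1 x * q_i y + q_i x * q_1 y + q_j x * q_ij y - q_ij x * q_j y)
       (q_1 x * q_j y - q_i x * q_ij y + q_j x * q_1 y + q_ij x * q_i y)
       (q_1 x * q_ij y + q_i x * q_j y - q_j x * q_i y + q_ij x * q_1 y).

Fact qaddA : associative qadd.
Proof. by move=> [????] [????] [????]; congr Quat => /=; ring. Qed.
Fact qaddC : commutative qadd.
Proof. by move=> [????] [????]; congr Quat => /=; ring. Qed.
Fact qadd0 : left_id qzero qadd.
Proof. by move=> [????]; congr Quat => /=; ring. Qed.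
Fact qaddN : left_inverse qzero qopp qadd.
Proof. by move=> [????]; congr Quat => /=; ring. Qed.
HB.instance Definition _ :=
  GRing.isZmodule.Build (quat R) qaddA qaddC qadd0 qaddN.

Fact qmulA : associative qmul.
Proof. by move=> [????] [????] [????]; congr Quat => /=; ring. Qed.
Fact qmul1l : left_id qone qmul.
Proof. by move=> [????]; congr Quat => /=; ring. Qed.
Fact qmul1r : right_id qone qmul.
Proof. by move=> [????]; congr Quat => /=; ring. Qed.
Fact qmulDl : left_distributive qmul qadd.
Proof. by move=> [????] [????] [????]; congr Quat => /=; ring. Qed.
Fact qmulDr : right_distributive qmul qadd.
Proof. by move=> [????] [????] [????]; congr Quat => /=; ring. Qed.
Fact qone_neq0 : qone != qzero.
Proof. by apply/eqP => -[] /eqP; rewrite oner_eq0. Qed.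
HB.instance Definition _ :=
  GRing.Zmodule_isNzRing.Build (quat R) qmulA qmul1l qmul1r qmulDl qmulDr
    qone_neq0.

Definition qconj x : quat R := Quat (q_1 x) (- q_i x) (- q_j x) (- q_ij x).

Definition qnorm x : R :=
  Num.sqrt (q_1 x ^+ 2 + q_i x ^+ 2 + q_j x ^+ 2 + q_ij x ^+ 2).

Definition qreal x : Prop := [/\ q_i x = 0, q_j x = 0 & q_ij x = 0].

(* [expi t] is e^{i t} and [expj t] is e^{j t}. *)
Definition expi (t : R) : quat R := Quat (cos t) (sin t) 0 0.
Definition expj (t : R) : quat R := Quat (cos t) 0 (sin t) 0.

End QuatRing.

Notation Z2 := (int * int)%type.

Section Gabor.
Variable R : realType.
Local Notation H := (quat R).
Implicit Types u f g : Z2 -> H.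

(* Unordered sum over Z^2: the sum of the positive parts minus the sum of the
   negative parts. It is meaningful for absolutely summable families only. *)
Definition rsum (a : Z2 -> R) : R :=
  fine (\esum_(k in [set: Z2]) (Num.max (a k) 0)%:E
        - \esum_(k in [set: Z2]) (Num.max (- a k) 0)%:E)%E.

Definition qsum (a : Z2 -> H) : H :=
  Quat (rsum (fun k => q_1 (a k))) (rsum (fun k => q_i (a k)))
       (rsum (fun k => q_j (a k))) (rsum (fun k => q_ij (a k))).

Definition sqnorm f : \bar R := (\esum_(k in [set: Z2]) (qnorm (f k) ^+ 2)%:E)%E.

Definition l2 f : Prop := (sqnorm f < +oo)%E.

Definition l2_real f : Prop := l2 f /\ forall k, qreal (f k).

Definition inner f g : H := qsum (fun k => qconj (f k) * g k).

(* [trans N n] is T_{nN}; [n *+ N] is (n_1 N, n_2 N). *)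
Definition trans (N : nat) (n : Z2) f : Z2 -> H := fun k => f (k - n *+ N).

(* [modul m] is E_{m/M}. *)
Definition modul (M : nat) (m : 'I_M * 'I_M) f : Z2 -> H := fun k =>
  expi (2 * pi * (m.1%:R / M%:R) * k.1%:~R) * f k
  * expj (2 * pi * (m.2%:R / M%:R) * k.2%:~R).

Definition gabor_sum (L M N : nat) (g : 'I_L -> Z2 -> H) f : \bar R :=
  (\sum_(l < L) \esum_(n in [set: Z2]) \sum_(m : 'I_M * 'I_M)
     (qnorm (inner (modul m (trans N n (g l))) f) ^+ 2)%:E)%E.

(* G(g, L, M, N) is a frame for l^2(Z x Z, H) with frame bounds A <= B. *)
Definition gabor_frame (L M N : nat) (g : 'I_L -> Z2 -> H) (A B : R) : Prop :=
  [/\ 0 < A, A <= B &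
      forall f, l2 f ->
        (A%:E * sqnorm f <= gabor_sum M N g f)%E /\
        (gabor_sum M N g f <= B%:E * sqnorm f)%E].

Definition Zmat := Z2 -> Z2 -> H.

Definition Zmat_tr (X : Zmat) : Zmat := fun p q => X q p.

Definition Zmat_mul (X Y : Zmat) : Zmat :=
  fun p q => qsum (fun n => X p n * Y n q).

Definition gmat (M N : nat) u (k : Z2) : Zmat :=
  fun p n => u (k + p *+ M - n *+ N).

(* M^2 max_k sum_p |(sum_l M_{u_l}(k) M_{u_l}^t(k))_{0,p}|, k in N_N^2;
   the maximum over an empty index set (N = 0) is -oo. *)
Definition gabor_pert (L M N : nat) (u : 'I_L -> Z2 -> H) : \bar R :=
  ((M ^ 2)%:R%:E *
   \big[maxe/-oo]_(k : 'I_N * 'I_N)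
     let k' : Z2 := ((k.1 : nat)%:Z, (k.2 : nat)%:Z) in
     \esum_(p in [set: Z2])
       (qnorm (\sum_(l < L)
          Zmat_mul (gmat M N (u l) k') (Zmat_tr (gmat M N (u l) k')) 0 p))%:E)%E.

End Gabor.

(* Main.v *)
Require Import Defs.
From mathcomp Require Import all_boot all_order all_algebra finmap.
From mathcomp Require Import ring lra zify.
From mathcomp Require Import all_classical all_reals all_analysis.
From mathcomp Require Import showcase.summability.

Set Implicit Arguments.
Unset Strict Implicit.
Unset Printing Implicit Defensive.

Import Order.TTheory GRing.Theory Num.Theory numFieldNormedType.Exports.
Local Open Scope classical_set_scope.
Local Open Scope ring_scope.

(* Put u = g - h. The perturbation h is handled by Minkowski's inequality once
   the Bessel bound sum |<E T u_l, f>|^2 <= rho |f|^2 is known. For f of finite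
   support, orthogonality of the characters (first those in j, which sit in the
   middle of conj(f(k)) e^{i..} e^{j..} f(k'), then those in i) turns the sum
   over m into
     M^2 sum_{k = k' mod M} Re(conj(f(k)) f(k')) G(k, k'),
   where G(k, k') = sum_l sum_n u_l(k - nN) u_l(k' - nN). As G is symmetric,
   2|f(k)||f(k')| <= |f(k)|^2 + |f(k')|^2 bounds this form by
   sum_k |f(k)|^2 M^2 sum_p |G(k, k + pM)|, and N-periodicity of G reduces the
   inner sum to k in N_N^2, where it is at most rho. The support restriction is
   removed by letting the truncations of f grow with n in a fixed finite set. *)

Existing Instance totally_filter.

(** * Unordered sums as limits over finite subsets; Minkowski's inequality *)

Section UnorderedSums.
Variables (R : realType) (T : choiceType).
Implicit Types (a b c : T -> R) (F : {fset T}).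

Lemma totally_superset F : \forall G \near totally, (F `<=` G)%fset.
Proof. by exists F. Qed.

Lemma le_sum_fset a F (G : {fset T}) :
  (forall k, 0 <= a k) -> (F `<=` G)%fset ->
  \sum_(k <- F) a k <= \sum_(k <- G) a k.
Proof.
move=> a0 FG; rewrite [leRHS](big_fsetID _ (fun k => k \in F)) /=.
have -> : [fset k in G | k \in F]%fset = F.
  apply/fsetP => k; rewrite !inE /=; case: (boolP (k \in F)) => kF; last first.
    by rewrite andbF.
  by rewrite (fsubsetP FG _ kF).
by rewrite lerDl sumr_ge0.
Qed.

Lemma sum_fset_le_esum a F : (forall k, 0 <= a k) ->
  ((\sum_(k <- F) a k)%:E <= \esum_(k in [set: T]) (a k)%:E)%E.
Proof.
move=> a0; apply: ereal_sup_ubound; exists [set` F].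
  by split => //; exact: finite_fset.
by rewrite fsbig_finite //= set_fsetK sumEFin.
Qed.

Lemma esum_le a (C : R) : (forall F, \sum_(k <- F) a k <= C) ->
  (\esum_(k in [set: T]) (a k)%:E <= C%:E)%E.
Proof.
move=> aC; apply: ge_ereal_sup => _ [X [finX _] <-].
by rewrite fsbig_finite // sumEFin lee_fin.
Qed.

Lemma esum_fineK a : (forall k, 0 <= a k) ->
  (\esum_(k in [set: T]) (a k)%:E < +oo)%E ->
  (fine (\esum_(k in [set: T]) (a k)%:E))%:E =
  (\esum_(k in [set: T]) (a k)%:E)%E.
Proof.
by move=> a0 afin; rewrite fineK // ge0_fin_numE // esum_ge0 // => k _;
  rewrite lee_fin.
Qed.

Lemma cvg_esum a : (forall k, 0 <= a k) ->
  (\esum_(k in [set: T]) (a k)%:E < +oo)%E ->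
  (fun F : {fset T} => \sum_(k <- F) a k) @ totally -->
  fine (\esum_(k in [set: T]) (a k)%:E).
Proof.
move=> a0 afin; have sE := esum_fineK a0 afin; move: sE.
set s := fine _ => sE.
have les F : \sum_(k <- F) a k <= s.
  by rewrite -lee_fin sE sum_fset_le_esum.
apply/cvgrPdist_le => e e0.
have [|x [X [finX _] <-]] := @ub_ereal_sup_adherent R
  [set (\sum_(k \in A) (a k)%:E)%E | A in fsets [set: T]] e e0.
  by rewrite -/(esum _ _) -sE.
rewrite -/(esum _ _) -sE fsbig_finite // sumEFin -EFinB lte_fin => lt_s.
apply: filterS (totally_superset (fset_set X)) => G XG /=.
rewrite ger0_norm ?subr_ge0 // lerBlDr -lerBlDl (le_trans (ltW lt_s)) //.
exact: le_sum_fset.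
Qed.

Lemma esum_lt_pinfty_le a b : (forall k, a k <= b k) ->
  (\esum_(k in [set: T]) (b k)%:E < +oo)%E ->
  (\esum_(k in [set: T]) (a k)%:E < +oo)%E.
Proof.
by move=> ab; apply: le_lt_trans; apply: le_esum => k _; rewrite lee_fin.
Qed.

Lemma esum_lt_pinftyD a b : (forall k, 0 <= a k) -> (forall k, 0 <= b k) ->
  (\esum_(k in [set: T]) (a k)%:E < +oo)%E ->
  (\esum_(k in [set: T]) (b k)%:E < +oo)%E ->
  (\esum_(k in [set: T]) (a k + b k)%:E < +oo)%E.
Proof.
move=> a0 b0 afin bfin.
under eq_esum do rewrite EFinD.
by rewrite esumD ?lte_add_pinfty // => k _; rewrite lee_fin.
Qed.

(** The family of inequalities in t encodes sqrt c <= sqrt a + sqrt b without square roots. For a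
    fixed t it can be summed over any finite set, and minimising the summed bound over t gives the
    square of the sum of the roots. *)
Lemma minkowski_esum a b c (al be : R) :
  0 <= al -> 0 <= be -> (forall k, 0 <= a k) -> (forall k, 0 <= b k) ->
  (forall t, 0 < t -> forall k, c k <= (1 + t) * a k + (1 + t^-1) * b k) ->
  (\esum_(k in [set: T]) (a k)%:E <= al%:E)%E ->
  (\esum_(k in [set: T]) (b k)%:E <= be%:E)%E ->
  (\esum_(k in [set: T]) (c k)%:E <= ((Num.sqrt al + Num.sqrt be) ^+ 2)%:E)%E.
Proof.
move=> al0 be0 a0 b0 cab ale ble; apply: esum_le => F.
have aF : \sum_(k <- F) a k <= al.
  by rewrite -lee_fin (le_trans _ ale) // sum_fset_le_esum.
have bF : \sum_(k <- F) b k <= be.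
  by rewrite -lee_fin (le_trans _ ble) // sum_fset_le_esum.
have cF t : 0 < t -> \sum_(k <- F) c k <= (1 + t) * al + (1 + t^-1) * be.
  move=> t0; rewrite (@le_trans _ _ ((1 + t) * (\sum_(k <- F) a k) +
    (1 + t^-1) * (\sum_(k <- F) b k))) //.
    by rewrite !mulr_sumr -big_split /= ler_sum // => k _; exact: cab.
  by rewrite lerD // ler_pM2l // addr_gt0 // invr_gt0.
set x := Num.sqrt al; set y := Num.sqrt be.
have x0 : 0 <= x by exact: sqrtr_ge0.
have y0 : 0 <= y by exact: sqrtr_ge0.
have alE : al = x ^+ 2 by rewrite sqr_sqrtr.
have beE : be = y ^+ 2 by rewrite sqr_sqrtr.
apply/ler_addgt0Pr => e e0.
(* The optimal t is y / x; the shift by d keeps it positive and finite. *)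
pose d := e / (x + y + 1).
have d0 : 0 < d by rewrite divr_gt0 // ltr_wpDl ?addr_ge0.
have xd0 : 0 < x + d by rewrite ltr_wpDl.
have yd0 : 0 < y + d by rewrite ltr_wpDl.
apply: (le_trans (cF ((y + d) / (x + d)) _)); first by rewrite divr_gt0.
have de : d * (x + y) <= e.
  rewrite /d -mulrA ger_pMr // mulrC ler_pdivrMr ?mul1r ?lerDl //.
  by rewrite ltr_wpDl ?addr_ge0.
have hx : (y + d) / (x + d) * al <= (y + d) * x.
  rewrite -mulrA ler_pM2l // mulrC ler_pdivrMr // alE expr2 ler_wpM2l //.
  by rewrite lerDl ltW.
have hy : ((y + d) / (x + d))^-1 * be <= (x + d) * y.
  rewrite invf_div -mulrA ler_pM2l // mulrC ler_pdivrMr // beE expr2.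
  rewrite ler_wpM2l //.
  by rewrite lerDl ltW.
rewrite [_ * al]mulrDl [_ * be]mulrDl !mul1r.
apply: (le_trans (lerD (lerD (lexx al) hx) (lerD (lexx be) hy))).
by rewrite alE beE; lra.
Qed.

End UnorderedSums.

(** * Absolutely summable real families on Z^2 *)

Section RealSums.
Variable R : realType.
Implicit Types a b : Z2 -> R.

Definition abs_summable a := (\esum_(k in [set: Z2]) `|a k|%:E < +oo)%E.

(** This turns positive part minus negative part into a limit of finite sums, from which linearity
    and limit inequalities follow. *)
Lemma cvg_rsum a : abs_summable a ->
  (fun F : {fset Z2} => \sum_(k <- F) a k) @ totally -->
  rsum a.
Proof.
move=> afin.
have pfin : (\esum_(k in [set: Z2]) (Num.max (a k) 0)%:E < +oo)%E.
  by apply: esum_lt_pinfty_le afin => k; rewrite ge_max ler_norm normr_ge0.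
have nfin : (\esum_(k in [set: Z2]) (Num.max (- a k) 0)%:E < +oo)%E.
  apply: esum_lt_pinfty_le afin => k; rewrite ge_max normr_ge0 andbT.
  by rewrite -normrN ler_norm.
have max0 (x : R) : 0 <= Num.max x 0 by rewrite le_max lexx orbT.
have -> : (fun F : {fset Z2} => \sum_(k <- F) a k) =
    (fun F : {fset Z2} => \sum_(k <- F) Num.max (a k) 0) \-
    (fun F : {fset Z2} => \sum_(k <- F) Num.max (- a k) 0).
  apply/funext => F /=; rewrite -sumrB; apply: eq_bigr => k _.
  by rewrite /Num.max; case: ltP => ?; case: ltP => ?; lra.
rewrite /rsum fineB.
- by apply: cvgB; apply: cvg_esum.
- by rewrite -(esum_fineK _ pfin).
- by rewrite -(esum_fineK _ nfin).
Qed.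

Lemma abs_summable_mul a b :
  (\esum_(k in [set: Z2]) (a k ^+ 2)%:E < +oo)%E ->
  (\esum_(k in [set: Z2]) (b k ^+ 2)%:E < +oo)%E ->
  abs_summable (fun k => a k * b k).
Proof.
move=> afin bfin.
apply: (@esum_lt_pinfty_le _ _ _ (fun k => a k ^+ 2 + b k ^+ 2)).
  move=> k; rewrite normrM -(real_normK (num_real (a k))).
  rewrite -(real_normK (num_real (b k))).
  have := normr_ge0 (a k); have := normr_ge0 (b k); nra.
by apply: esum_lt_pinftyD => // k; exact: sqr_ge0.
Qed.

Lemma esum_shift (a : Z2 -> \bar R) (c : Z2) :
  (\esum_(k in [set: Z2]) a (k + c)%R = \esum_(k in [set: Z2]) a k)%E.
Proof.
symmetry; apply: (reindex_esum setT setT (fun k : Z2 => k + c)).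
split => //; first by move=> x y _ _; exact: addIr.
by move=> y _; exists (y - c) => //; rewrite subrK.
Qed.

Lemma rsum_shift a c : rsum (fun k => a (k + c)) = rsum a.
Proof.
rewrite /rsum (esum_shift (fun k => (Num.max (a k) 0)%:E)).
by rewrite (esum_shift (fun k => (Num.max (- a k) 0)%:E)).
Qed.

End RealSums.

(** * Quaternion algebra and orthogonality of the characters *)

Section Quaternions.
Variable R : realType.
Implicit Types x y z : quat R.

Definition qsq x : R := q_1 x ^+ 2 + q_i x ^+ 2 + q_j x ^+ 2 + q_ij x ^+ 2.

Definition qscal (a : R) : quat R := Quat a 0 0 0.

Lemma qsq_ge0 x : 0 <= qsq x.
Proof. by rewrite !addr_ge0 // sqr_ge0. Qed.

Lemma sqr_qnorm x : qnorm x ^+ 2 = qsq x.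
Proof. by rewrite sqr_sqrtr // qsq_ge0. Qed.

Lemma qsqM x y : qsq (x * y) = qsq x * qsq y.
Proof. by case: x y => [????] [????]; rewrite /qsq /=; ring. Qed.

Lemma qsq_conj x : qsq (qconj x) = qsq x.
Proof. by case: x => [????]; rewrite /qsq /=; ring. Qed.

Lemma qsqE x : qsq x = q_1 (qconj x * x).
Proof. by case: x => [????]; rewrite /qsq /=; ring. Qed.

Lemma qsq_eq0 x : qsq x = 0 -> x = 0.
Proof.
case: x => a b c d; rewrite /qsq /= => e; congr Quat; nra.
Qed.

(** In each coordinate the right side exceeds the left by t^-1 (t a - b)^2. This is the weighted
    form that [minkowski_esum] consumes. *)
Lemma qsqD_le t x y : 0 < t ->
  qsq (x + y) <= (1 + t) * qsq x + (1 + t^-1) * qsq y.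
Proof.
move=> t0; have ti0 : 0 < t^-1 by rewrite invr_gt0.
have sq (a b : R) : (a + b) ^+ 2 <= (1 + t) * a ^+ 2 + (1 + t^-1) * b ^+ 2.
  have -> : (1 + t) * a ^+ 2 + (1 + t^-1) * b ^+ 2
      = (a + b) ^+ 2 + t^-1 * (t * a - b) ^+ 2.
    by field; rewrite gt_eqF.
  by rewrite lerDl mulr_ge0 ?sqr_ge0 // ltW.
case: x y => [x1 x2 x3 x4] [y1 y2 y3 y4]; rewrite /qsq /=.
have := sq x1 y1; have := sq x2 y2; have := sq x3 y3; have := sq x4 y4.
by lra.
Qed.

Lemma qsqN x : qsq (- x) = qsq x.
Proof. by case: x => [????]; rewrite /qsq /=; ring. Qed.

Lemma normr_coord_le (c : quat R -> R) x :
  c x ^+ 2 <= qsq x -> `|c x| <= qnorm x.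
Proof. by move=> cx; rewrite -sqrtr_sqr ler_sqrt ?qsq_ge0. Qed.

(** The norm is multiplicative, so the claim reduces to the inequality of arithmetic and geometric
    means. Leaving [c] general covers all four coordinates at once. *)
Lemma normr_coord_conjM_le (c : quat R -> R) x y :
  (forall z, c z ^+ 2 <= qsq z) ->
  `|c (qconj x * y)| <= (qsq x + qsq y) / 2.
Proof.
move=> cle; apply: (le_trans (normr_coord_le (cle _))).
have -> : qnorm (qconj x * y) = Num.sqrt (qsq x) * Num.sqrt (qsq y).
  by rewrite -sqrtrM ?qsq_ge0 // -(qsq_conj x) -qsqM.
rewrite -{2}(sqr_sqrtr (qsq_ge0 x)) -{2}(sqr_sqrtr (qsq_ge0 y)).
have := sqr_ge0 (Num.sqrt (qsq x) - Num.sqrt (qsq y)); lra.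
Qed.

Lemma sqr_q_1_le x : q_1 x ^+ 2 <= qsq x.
Proof. by rewrite /qsq -!addrA lerDl !addr_ge0 // sqr_ge0. Qed.

Lemma sqr_q_i_le x : q_i x ^+ 2 <= qsq x.
Proof.
by rewrite /qsq -!addrA addrCA lerDl !addr_ge0 // sqr_ge0.
Qed.

Lemma sqr_q_j_le x : q_j x ^+ 2 <= qsq x.
Proof. by rewrite /qsq addrAC lerDr !addr_ge0 // sqr_ge0. Qed.

Lemma sqr_q_ij_le x : q_ij x ^+ 2 <= qsq x.
Proof. by rewrite /qsq lerDr !addr_ge0 // sqr_ge0. Qed.

Section Sums.
Variables (I : Type) (r : seq I) (P : pred I) (a : I -> quat R).

Lemma q_1_sum : q_1 (\sum_(i <- r | P i) a i) = \sum_(i <- r | P i) q_1 (a i).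
Proof. exact: big_morph. Qed.

Lemma q_i_sum : q_i (\sum_(i <- r | P i) a i) = \sum_(i <- r | P i) q_i (a i).
Proof. exact: big_morph. Qed.

Lemma q_j_sum : q_j (\sum_(i <- r | P i) a i) = \sum_(i <- r | P i) q_j (a i).
Proof. exact: big_morph. Qed.

Lemma q_ij_sum :
  q_ij (\sum_(i <- r | P i) a i) = \sum_(i <- r | P i) q_ij (a i).
Proof. exact: big_morph. Qed.

Lemma qconj_sum :
  qconj (\sum_(i <- r | P i) a i) = \sum_(i <- r | P i) qconj (a i).
Proof.
apply: (big_morph (@qconj R)); last by congr Quat => /=; rewrite oppr0.
by move=> [????] [????]; congr Quat => /=; ring.
Qed.

End Sums.

Lemma qsq_sum (I : Type) (r : seq I) (a : I -> quat R) :
  qsq (\sum_(i <- r) a i) =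
  \sum_(i <- r) \sum_(j <- r) q_1 (qconj (a i) * a j).
Proof.
rewrite qsqE qconj_sum mulr_suml q_1_sum; apply: eq_bigr => i _.
by rewrite mulr_sumr q_1_sum.
Qed.

Lemma expiD (s t : R) : expi (s + t) = expi s * expi t.
Proof. by rewrite /expi cosD sinD; congr Quat => /=; ring. Qed.

Lemma expiMn (s : R) n : expi (s *+ n) = expi s ^+ n.
Proof.
elim: n => [|n IHn]; first by rewrite mulr0n expr0 /expi cos0 sin0.
by rewrite mulrS expiD IHn exprS.
Qed.

Lemma expi_2pi_int (d : int) : expi (2 * pi * d%:~R) = 1 :> quat R.
Proof.
have nat2pi n : expi (2 * pi * n%:R) = 1 :> quat R.
  rewrite mulr_natr expiMn mulr_natl.
  by rewrite /expi cos2pi sin2pi expr1n.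
case: d => n; first exact: nat2pi.
rewrite NegzE mulrNz mulrN -[LHS]mulr1 -[X in _ * X = _](nat2pi n.+1).
by rewrite -expiD addNr /expi cos0 sin0.
Qed.

Lemma qsq_expi (t : R) : qsq (expi t) = 1.
Proof. by rewrite /qsq /= expr0n !addr0 cos2Dsin2. Qed.

Lemma qsq_expj (t : R) : qsq (expj t) = 1.
Proof. by rewrite /qsq /= expr0n !addr0 cos2Dsin2. Qed.

Definition angle (M : nat) (m : 'I_M) (k : int) : R :=
  2 * pi * (m%:R / M%:R) * k%:~R.

(** Halve the angle: cos (2 phi) = 1 would force sin phi = 0, but phi = pi r / M lies strictly
    between 0 and pi. *)
Lemma expi_neq1 (M r : nat) : (0 < r < M)%N ->
  expi (2 * pi * (r%:R / M%:R)) != 1 :> quat R.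
Proof.
move=> /andP[r0 rM]; apply/eqP => -[+ _].
pose phi : R := pi * (r%:R / M%:R).
have -> : 2 * pi * (r%:R / M%:R) = phi *+ 2 by rewrite /phi; ring.
rewrite cos_mulr2n => cE.
have M0 : 0 < M%:R :> R by rewrite ltr0n (ltn_trans r0).
have : 0 < sin phi.
  apply: sin_gt0_pi; apply/andP; split.
    by rewrite mulr_gt0 ?pi_gt0 // divr_gt0 // ltr0n.
  by rewrite gtr_pMr ?pi_gt0 // ltr_pdivrMr // mul1r ltr_nat.
have := cos2Dsin2 phi; nra.
Qed.

(** This is a geometric sum in an M-th root of unity [w], so (w - 1) times the sum vanishes. Either
    M divides d and w = 1, or w differs from 1 and the sum is 0. *)
Lemma sum_expi (M : nat) (d : int) : (0 < M)%N ->
  \sum_(m < M) expi (angle m d) = qscal ((M%:Z %| d)%Z * M)%:R.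
Proof.
move=> M0; have M0R : M%:R != 0 :> R by rewrite pnatr_eq0 -lt0n.
pose w : quat R := expi (2 * pi * d%:~R / M%:R).
have -> : \sum_(m < M) expi (angle m d) = \sum_(m < M) w ^+ m.
  apply: eq_bigr => m _; rewrite -expiMn -mulr_natl /angle; congr expi.
  by field.
have wM : (w - 1) * \sum_(m < M) w ^+ m = 0.
  rewrite -subrX1 -expiMn -[_ *+ M]mulr_natl.
  have -> : M%:R * (2 * pi * d%:~R / M%:R) = 2 * pi * d%:~R :> R by field.
  by rewrite expi_2pi_int subrr.
have dE : d%:~R = (d %/ M)%Z%:~R * M%:R + (d %% M)%Z%:~R :> R.
  by rewrite {1}(divz_eq d M) rmorphD rmorphM.
(* Full turns drop out, so only the residue of d mod M matters; [expi_neq1] applies when it is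
   nonzero. *)
have wE : w = expi (2 * pi * ((d %% M)%Z%:~R / M%:R)).
  rewrite -[RHS]mul1r -(expi_2pi_int (d %/ M)%Z) -expiD; congr expi.
  by rewrite dE; field.
have r_ge0 : (0 <= (d %% M)%Z)%R by apply: modz_ge0; rewrite eqz_nat -lt0n.
case: (boolP (M%:Z %| d)%Z) => [/dvdz_mod0P dM|ndvd].
  have -> : w = 1 by rewrite wE dM mul0r mulr0 /expi cos0 sin0.
  rewrite mul1n.
  under eq_bigr do rewrite expr1n.
  rewrite sumr_const card_ord.
  elim: M%N {M0 M0R w wM dE wE r_ge0 dM} => [|n IHn]; first by rewrite mulr0n.
  by rewrite mulrS IHn; congr Quat => /=; rewrite ?addr0 // -[RHS]natr1 addrC.
rewrite mul0n; apply: qsq_eq0.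
(* Multiplicativity of [qsq] stands in for the absence of zero divisors. *)
have /eqP : qsq ((w - 1) * \sum_(m < M) w ^+ m) = 0.
  by rewrite wM /qsq /= expr0n !addr0.
rewrite qsqM mulf_eq0 => /orP[/eqP /qsq_eq0 /eqP|/eqP //].
rewrite subr_eq0 wE.
have rM : ((d %% M)%Z < M%:Z)%R by exact: ltz_pmod.
have r_neq0 : (d %% M)%Z != 0.
  by apply: contra ndvd => /eqP ?; apply/dvdz_mod0P.
case: (d %% M)%Z r_ge0 rM r_neq0 => // r _ rM r0.
rewrite (negbTE (@expi_neq1 M r _)) //; lia.
Qed.

Lemma sum_expj (M : nat) (d : int) : (0 < M)%N ->
  \sum_(m < M) expj (angle m d) = qscal ((M%:Z %| d)%Z * M)%:R.
Proof.
move=> M0; have := @sum_expi M d M0.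
set s := \sum_(m < M) _ => sE; set t := \sum_(m < M) _.
(* The two exponentials have the same coordinates up to exchanging i and j. *)
have -> : t = Quat (q_1 s) 0 (q_i s) 0.
  have tE : t = Quat (q_1 t) (q_i t) (q_j t) (q_ij t) by case: t.
  by rewrite tE /s /t !(q_1_sum, q_i_sum, q_j_sum, q_ij_sum) /= !big1_eq.
by rewrite sE.
Qed.

Lemma angleB (M : nat) (m : 'I_M) (k l : int) :
  angle m (k - l) = angle m k - angle m l.
Proof. by rewrite /angle rmorphB mulrBr. Qed.

Lemma qscal_comm (a : R) x : qscal a * x = x * qscal a.
Proof. by case: x => [????]; congr Quat => /=; ring. Qed.

Lemma qscalM (a b : R) : qscal a * qscal b = qscal (a * b).
Proof. by congr Quat => /=; ring. Qed.

Lemma qconjM x y : qconj (x * y) = qconj y * qconj x.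
Proof. by case: x y => [????] [????]; congr Quat => /=; ring. Qed.

Lemma qconjK x : qconj (qconj x) = x.
Proof. by case: x => [????]; congr Quat => /=; ring. Qed.

Lemma q_1_qscalM (a : R) x : q_1 (qscal a * x) = a * q_1 x.
Proof. by case: x => [????] /=; ring. Qed.

Lemma qrealE x : qreal x -> x = qscal (q_1 x).
Proof. by case: x => [????] [/= -> -> ->]. Qed.

Definition eqmodZ2 (M : nat) (k l : Z2) : bool :=
  (M%:Z %| k.1 - l.1)%Z && (M%:Z %| k.2 - l.2)%Z.

Lemma sum_modul (M : nat) (v : Z2 -> quat R) (k l : Z2) x y : (0 < M)%N ->
  (forall n, qreal (v n)) ->
  \sum_(m : 'I_M * 'I_M)
    q_1 (qconj (qconj (modul m v k) * x) * (qconj (modul m v l) * y)) =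
  (M ^ 2)%:R * (eqmodZ2 M k l)%:R * (q_1 (v k) * q_1 (v l)) * q_1 (qconj x * y).
Proof.
move=> M0 vreal; rewrite -q_1_sum.
have conj_expi (s : R) : qconj (expi s) = expi (- s).
  by rewrite /expi cosN sinN; congr Quat => /=; rewrite oppr0.
have conj_expj (s : R) : qconj (expj s) = expj (- s).
  by rewrite /expj cosN sinN; congr Quat => /=; rewrite oppr0.
have expjB (s t : R) : expj (s - t) = expj s * expj (- t).
  by rewrite /expj cosD sinD; congr Quat => /=; ring.
pose b := qscal (q_1 (v k) * q_1 (v l)).
have termE (m : 'I_M * 'I_M) :
    qconj (qconj (modul m v k) * x) * (qconj (modul m v l) * y) =
    b * (qconj x * (expi (angle m.1 k.1) * expj (angle m.2 (k.2 - l.2)) *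
      expi (- angle m.1 l.1)) * y).
  rewrite /modul -!/(angle _ _) qconjM qconjK.
  rewrite (qrealE (vreal k)) (qrealE (vreal l)) !qconjM.
  rewrite conj_expi conj_expj angleB expjB /b -qscalM.
  have -> (a : R) : qconj (qscal a) = qscal a.
    by congr Quat => /=; rewrite oppr0.
  (* The values of v are real, hence central, and move to the front. *)
  rewrite !mulrA -[_ * qscal (q_1 (v l))]qscal_comm.
  by rewrite !mulrA -[_ * qscal (q_1 (v k))]qscal_comm !mulrA.
have sumE : \sum_(m : 'I_M * 'I_M) (expi (angle m.1 k.1) *
    expj (angle m.2 (k.2 - l.2)) * expi (- angle m.1 l.1)) =
    qscal ((M ^ 2)%:R * (eqmodZ2 M k l)%:R).
  rewrite -(pair_big xpredT xpredT (fun m1 m2 : 'I_M => expi (angle m1 k.1) *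
    expj (angle m2 (k.2 - l.2)) * expi (- angle m1 l.1))) /=.
  (* The inner sum over m2 is a real scalar. Once it is moved out, the two i-exponentials become
     adjacent and merge into one at k.1 - l.1. *)
  under eq_bigr => m1 _.
    rewrite -mulr_suml -mulr_sumr sum_expj // -qscal_comm -mulrA -expiD -angleB.
    over.
  rewrite -mulr_sumr sum_expi // qscalM /eqmodZ2 -!natrM; congr (qscal _%:R).
  rewrite -mulnn.
  by case: (M%:Z %| k.1 - l.1)%Z; case: (M%:Z %| k.2 - l.2)%Z => /=; ring.
under eq_bigr do rewrite termE.
rewrite -mulr_sumr -mulr_suml -mulr_sumr sumE -qscal_comm -mulrA !q_1_qscalM.
by rewrite mulrCA mulrA.
Qed.
End Quaternions.

(** * Finite approximation and additivity of the inner product *)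

Section InnerProduct.
Variable R : realType.
Implicit Types (f g : Z2 -> quat R) (F : {fset Z2}).

Lemma sqnormE f : sqnorm f = (\esum_(k in [set: Z2]) (qsq (f k))%:E)%E.
Proof. by apply: eq_esum => k _; rewrite sqr_qnorm. Qed.

Lemma l2D f g : l2 f -> l2 g -> l2 (fun k => f k + g k).
Proof.
rewrite /l2 !sqnormE => fl2 gl2.
apply: (@esum_lt_pinfty_le _ _ _
  (fun k => (qsq (f k) + qsq (f k)) + (qsq (g k) + qsq (g k)))) => [k|].
  by have := qsqD_le (f k) (g k) (@ltr01 R); rewrite invr1; lra.
have dbl a : (\esum_(k in [set: Z2]) (qsq (a k))%:E < +oo)%E ->
    (\esum_(k in [set: Z2]) (qsq (a k) + qsq (a k))%:E < +oo)%E.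
  by move=> al2; apply: esum_lt_pinftyD => // k; exact: qsq_ge0.
by apply: esum_lt_pinftyD; [..|exact: dbl|exact: dbl] => k;
  rewrite addr_ge0 ?qsq_ge0.
Qed.

Lemma l2N f : l2 f -> l2 (fun k => - f k).
Proof.
by rewrite /l2 !sqnormE; under [in X in _ -> X]eq_esum do rewrite qsqN.
Qed.

Lemma l2_realN f : l2_real f -> l2_real (fun k => - f k).
Proof.
move=> [fl2 freal]; split=> [|k]; first exact: l2N.
by have [e1 e2 e3] := freal k; split; rewrite /= ?e1 ?e2 ?e3 oppr0.
Qed.

Lemma l2_realD f g : l2_real f -> l2_real g -> l2_real (fun k => f k + g k).
Proof.
move=> [fl2 freal] [gl2 greal]; split=> [|k]; first exact: l2D.
have [e1 e2 e3] := freal k; have [d1 d2 d3] := greal k.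
by split; rewrite /= ?e1 ?e2 ?e3 ?d1 ?d2 ?d3 addr0.
Qed.

Lemma l2_atom M N (m : 'I_M * 'I_M) n f : l2 f -> l2 (modul m (trans N n f)).
Proof.
rewrite /l2 !sqnormE /trans => fl2.
have -> : (\esum_(k in [set: Z2])
      (qsq (modul m (fun k => f (k - n *+ N)) k))%:E =
    \esum_(k in [set: Z2]) (qsq (f (k - n *+ N)))%:E)%E.
  by apply: eq_esum => k _; rewrite /modul !qsqM qsq_expi qsq_expj mul1r mulr1.
by rewrite (esum_shift (fun k => (qsq (f k))%:E)).
Qed.

Section Coordinate.
Variable c : quat R -> R.
Hypotheses (cle : forall z, c z ^+ 2 <= qsq z) (cD : {morph c : x y / x + y}).
Hypothesis c0 : c 0 = 0.

(** Each term is at most |f(k)|^2 + |g(k)|^2 in absolute value, so the coordinate series converges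
    absolutely. *)
Lemma cvg_coord_inner f g : l2 f -> l2 g ->
  (fun F => c (\sum_(k <- F) qconj (f k) * g k)) @ totally -->
  rsum (fun k => c (qconj (f k) * g k)).
Proof.
rewrite /l2 !sqnormE => fl2 gl2.
have -> : (fun F => c (\sum_(k <- F) qconj (f k) * g k)) =
    (fun F => \sum_(k <- F) c (qconj (f k) * g k)).
  by apply/funext => F; rewrite (big_morph c cD c0).
apply: cvg_rsum.
apply: (@esum_lt_pinfty_le _ _ _ (fun k => qsq (f k) + qsq (g k))) => [k|].
  have := normr_coord_conjM_le (f k) (g k) cle.
  by have := qsq_ge0 (f k); have := qsq_ge0 (g k); lra.
by apply: esum_lt_pinftyD => // k; exact: qsq_ge0.
Qed.

Lemma rsum_coordD f1 f2 g : l2 f1 -> l2 f2 -> l2 g ->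
  rsum (fun k => c (qconj (f1 k + f2 k) * g k)) =
  rsum (fun k => c (qconj (f1 k) * g k)) +
  rsum (fun k => c (qconj (f2 k) * g k)).
Proof.
move=> f1l2 f2l2 gl2.
(* Both sides are limits of the same finite sums. *)
apply: (@cvg_unique R^o (@norm_hausdorff _ R^o) _ _ _ _
  (cvg_coord_inner (l2D f1l2 f2l2) gl2)).
have -> : (fun F => c (\sum_(k <- F) qconj (f1 k + f2 k) * g k)) =
    (fun F => c (\sum_(k <- F) qconj (f1 k) * g k)) \+
    (fun F => c (\sum_(k <- F) qconj (f2 k) * g k)).
  apply/funext => F /=; rewrite -cD -big_split; congr c.
  apply: eq_bigr => k _ /=; rewrite -mulrDl; congr (_ * _).
  by case: (f1 k) (f2 k) => [????] [????]; congr Quat => /=; ring.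
by apply: cvgD; exact: cvg_coord_inner.
Qed.

End Coordinate.

Lemma innerD f1 f2 g : l2 f1 -> l2 f2 -> l2 g ->
  inner (fun k => f1 k + f2 k) g = inner f1 g + inner f2 g.
Proof.
move=> f1l2 f2l2 gl2; rewrite /inner /qsum.
rewrite (rsum_coordD (@sqr_q_1_le _) _ _ f1l2 f2l2 gl2) //.
rewrite (rsum_coordD (@sqr_q_i_le _) _ _ f1l2 f2l2 gl2) //.
rewrite (rsum_coordD (@sqr_q_j_le _) _ _ f1l2 f2l2 gl2) //.
by rewrite (rsum_coordD (@sqr_q_ij_le _) _ _ f1l2 f2l2 gl2).
Qed.

Lemma cvg_qsq_inner f g : l2 f -> l2 g ->
  (fun F => qsq (\sum_(k <- F) qconj (f k) * g k)) @ totally -->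
  qsq (inner f g).
Proof.
move=> fl2 gl2; rewrite /qsq; apply: cvgD; first apply: cvgD; first apply: cvgD.
all: rewrite expr2; apply: cvgM; apply: cvg_coord_inner => //.
all: by [exact: sqr_q_1_le | exact: sqr_q_i_le
        |exact: sqr_q_j_le | exact: sqr_q_ij_le].
Qed.

Lemma sum_qsq_modul (M : nat) (v : Z2 -> quat R) f F : (0 < M)%N ->
  (forall k, qreal (v k)) ->
  \sum_(m : 'I_M * 'I_M) qsq (\sum_(k <- F) qconj (modul m v k) * f k) =
  \sum_(k <- F) \sum_(l <- F) (M ^ 2)%:R * (eqmodZ2 M k l)%:R *
    q_1 (qconj (f k) * f l) * (q_1 (v k) * q_1 (v l)).
Proof.
move=> M0 vreal; under eq_bigr do rewrite qsq_sum.
rewrite exchange_big; apply: eq_bigr => k _.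
rewrite exchange_big; apply: eq_bigr => l _.
by rewrite sum_modul // mulrAC.
Qed.

End InnerProduct.

(** * Congruences and division with remainder in Z^2 *)

Lemma mulrnZ2E (M : nat) (k : Z2) :
  (k *+ M).1 = k.1 *+ M /\ (k *+ M).2 = k.2 *+ M.
Proof. by elim: M => [|M [IH1 IH2]]; rewrite ?mulr0n // !mulrS /= IH1 IH2. Qed.

Lemma eqZ2 (k l : Z2) : k.1 = l.1 -> k.2 = l.2 -> k = l.
Proof. by case: k l => [? ?] [? ?] /= -> ->. Qed.

Lemma eqmodZ2P (M : nat) (k l : Z2) :
  reflect (exists p : Z2, k + p *+ M = l) (eqmodZ2 M k l).
Proof.
apply: (iffP andP) => [[/dvdzP[p1 e1] /dvdzP[p2 e2]]|[p <-]].
  (* The quotients are those of k - l, while the witness must lead from k to l; hence the signs. *)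
  exists (- p1, - p2); case: (mulrnZ2E M (- p1, - p2)) => h1 h2.
  by apply: eqZ2; rewrite /= ?h1 ?h2 /= -mulr_natr; lia.
case: (mulrnZ2E M p) => h1 h2 /=; rewrite h1 h2.
split; apply/dvdzP; [exists (- p.1) | exists (- p.2)]; rewrite -mulr_natr; lia.
Qed.

Lemma Z2_divmod (N : nat) (k : Z2) : (0 < N)%N ->
  exists (r : 'I_N * 'I_N) (a : Z2),
    k = ((r.1 : nat)%:Z, (r.2 : nat)%:Z) + a *+ N.
Proof.
move=> N0.
have div1 (d : int) : exists (r : 'I_N) (q : int), d = (r : nat)%:Z + q *+ N.
  have : (0 <= (d %% N)%Z)%R by apply: modz_ge0; rewrite eqz_nat -lt0n.
  have : ((d %% N)%Z < N%:Z)%R by exact: ltz_pmod.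
  have := divz_eq d N; case: (d %% N)%Z => // r dE; rewrite ltz_nat => rN _.
  by exists (Ordinal rN), (d %/ N)%Z; rewrite /= -[_ *+ N]mulr_natr natz addrC.
have [r1 [a1 e1]] := div1 k.1; have [r2 [a2 e2]] := div1 k.2.
exists (r1, r2), (a1, a2); case: (mulrnZ2E N (a1, a2)) => h1 h2.
by apply: eqZ2; rewrite /= ?h1 ?h2.
Qed.

Lemma mulrnZ2_inj (M : nat) : (0 < M)%N -> injective (fun p : Z2 => p *+ M).
Proof.
move=> M0 p q e; case: (mulrnZ2E M p) (mulrnZ2E M q) => p1 p2 [q1 q2].
have [e1 e2] : (p.1 *+ M = q.1 *+ M) /\ (p.2 *+ M = q.2 *+ M).
  by rewrite -p1 -p2 -q1 -q2 e.
move: p q e1 e2 {e p1 p2 q1 q2} => [p1 p2] [q1 q2] /= e1 e2.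
by congr pair; apply: (@pmulrnI _ M).
Qed.

(** * The Bessel bound [rho] for the system generated by [u] *)

Section GaborBessel.
Variables (R : realType) (L M N : nat) (u : 'I_L -> Z2 -> quat R).
Hypotheses (M_gt0 : (0 < M)%N) (N_gt0 : (0 < N)%N).
Hypothesis u_l2 : forall l, l2_real (u l).
Implicit Types (f : Z2 -> quat R) (F : {fset Z2}).

(** The kernel G of the overview. Real coordinates suffice because each [u i] is real-valued. *)
Definition gram (k l : Z2) : R :=
  \sum_(i < L) rsum (fun n => q_1 (u i (k - n *+ N)) * q_1 (u i (l - n *+ N))).

Lemma gramC k l : gram k l = gram l k.
Proof.
apply: eq_bigr => i _; congr rsum; apply/funext => n; exact: mulrC.
Qed.

Lemma gram_shift k l a : gram (k + a *+ N) (l + a *+ N) = gram k l.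
Proof.
apply: eq_bigr => i _; rewrite -[LHS](rsum_shift _ a); congr rsum.
have shiftE (n x : Z2) : x + a *+ N - (n + a) *+ N = x - n *+ N.
  by rewrite mulrnDl opprD addrACA subrr addr0.
by apply/funext => n; rewrite !shiftE.
Qed.

(** Since n -> k - nN is injective, each factor is square summable in n, its squares forming part of
    the full square sum of [u i]. *)
Lemma abs_summable_gram i k l :
  abs_summable (fun n => q_1 (u i (k - n *+ N)) * q_1 (u i (l - n *+ N))).
Proof.
have sq k' : (\esum_(n in [set: Z2]) (q_1 (u i (k' - n *+ N)) ^+ 2)%:E < +oo)%E.
  have [ul2 _] := u_l2 i; move: ul2; rewrite /l2 sqnormE; apply: le_lt_trans.
  apply: (@le_trans _ _
    (\esum_(n in [set: Z2]) (qsq (u i (k' - n *+ N)))%:E)%E).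
    by apply: le_esum => n _; rewrite lee_fin sqr_q_1_le.
  rewrite -(esum_image setT (fun n : Z2 => k' - n *+ N)
    (fun k => (qsq (u i k))%:E)); last first.
    by move=> x y _ _ /addrI /oppr_inj; exact: mulrnZ2_inj.
  rewrite esum_mkcond; apply: le_esum => x _.
  by case: ifP => // _; rewrite lee_fin qsq_ge0.
exact: abs_summable_mul.
Qed.

Lemma q_1_Zmat_mul_gram k : (forall p, q_1 (\sum_(l < L)
    Zmat_mul (gmat M N (u l) k) (Zmat_tr (gmat M N (u l) k)) 0 p) =
  gram k (k + p *+ M)).
Proof.
move=> p; rewrite q_1_sum; apply: eq_bigr => i _ /=; congr rsum.
apply/funext => n; rewrite /Zmat_tr /gmat mul0rn addr0.
have [_ ureal] := u_l2 i.
have [e1 e2 e3] := ureal (k - n *+ N).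
by rewrite /= e1 e2 e3 !mul0r !subr0.
Qed.

Variable rho : R.
Hypothesis rho_ge : (gabor_pert M N u <= rho%:E)%E.

Lemma esum_gram_le k :
  ((M ^ 2)%:R%:E * (\esum_(p in [set: Z2]) `|gram k (k + p *+ M)|%:E)
    <= rho%:E)%E.
Proof.
(* Periodicity of [gram] moves k to its residue in N_N^2, where the maximum in [gabor_pert]
   applies. *)
have [r [a ->]] := Z2_divmod k N_gt0; set k' : Z2 := (_, _).
apply: le_trans rho_ge; apply: lee_wpmul2l; first by rewrite lee_fin ler0n.
apply: le_trans (le_bigmax _ _ r); apply: le_esum => p _; rewrite lee_fin.
rewrite addrAC gram_shift -q_1_Zmat_mul_gram; apply: normr_coord_le.
exact: sqr_q_1_le.
Qed.

(** The points congruent to k mod M are parametrised injectively by p -> k + pM, so the finite sum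
    is part of the row sum in [esum_gram_le]. *)
Lemma sum_gram_le k F :
  (M ^ 2)%:R * \sum_(l <- F) (eqmodZ2 M k l)%:R * `|gram k l| <= rho.
Proof.
rewrite -lee_fin; apply: le_trans (esum_gram_le k); rewrite EFinM.
apply: lee_wpmul2l; first by rewrite lee_fin ler0n.
rewrite -(esum_image setT (fun p : Z2 => k + p *+ M)
  (fun l => `|gram k l|%:E)); last first.
  by move=> x y _ _ /addrI; exact: mulrnZ2_inj.
rewrite esum_mkcond.
have -> : (fun l => if l \in [set k + p *+ M | p in [set: Z2]]
     then `|gram k l|%:E else 0%E) =
   (fun l => ((eqmodZ2 M k l)%:R * `|gram k l|)%:E).
  apply/funext => l; case: ifPn.
    rewrite inE => -[p _ <-].
    by rewrite (introT (eqmodZ2P _ _ _)) ?mul1r //; exists p.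
  case: eqmodZ2P; last by rewrite mul0r.
  by move=> [p <-]; rewrite notin_setE => -[]; exists p.
by apply: sum_fset_le_esum => l; rewrite mulr_ge0 ?ler0n.
Qed.

Lemma rho_ge0 : 0 <= rho.
Proof. by have := sum_gram_le 0 fset0; rewrite big_nil mulr0. Qed.

(** The frame coefficient of f truncated to F. *)
Definition atom_coeff f F (i : 'I_L) (m : 'I_M * 'I_M) (n : Z2) : quat R :=
  \sum_(k <- F) qconj (modul m (trans N n (u i)) k) * f k.

Lemma gram_form_le f F :
  \sum_(k <- F) \sum_(l <- F) (M ^ 2)%:R * (eqmodZ2 M k l)%:R *
    q_1 (qconj (f k) * f l) * gram k l <= rho * \sum_(k <- F) qsq (f k).
Proof.
(* The factor 1/2 comes from |x||y| <= (|x|^2 + |y|^2) / 2. As [w] is symmetric, the two resulting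
   double sums agree and together restore the full row sums. *)
pose w k l := (M ^ 2)%:R * ((eqmodZ2 M k l)%:R * `|gram k l|) / 2.
have w0 k l : 0 <= w k l by rewrite /w !mulr_ge0 // ?ler0n ?invr_ge0.
have eqmodC k l : eqmodZ2 M k l = eqmodZ2 M l k.
  by rewrite /eqmodZ2 -(opprB l.1) -(opprB l.2) !dvdzE !abszN.
apply: (@le_trans _ _ (\sum_(k <- F) \sum_(l <- F)
    (w k l * qsq (f k) + w k l * qsq (f l)))).
  apply: ler_sum => k _; apply: ler_sum => l _.
  apply: (le_trans (ler_norm _)); rewrite !normrM !normr_nat.
  have := normr_coord_conjM_le (f k) (f l) (@sqr_q_1_le _).
  have -> : (M ^ 2)%:R * (eqmodZ2 M k l)%:R * `|q_1 (qconj (f k) * f l)| *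
    `|gram k l| = w k l * 2 * `|q_1 (qconj (f k) * f l)| by rewrite /w; field.
  by have := w0 k l; nra.
under eq_bigr do rewrite big_split /=.
rewrite big_split /= [X in _ + X]exchange_big /=.
have -> : \sum_(l <- F) \sum_(k <- F) w k l * qsq (f l) =
    \sum_(k <- F) \sum_(l <- F) w k l * qsq (f k).
  by apply: eq_bigr => k _; apply: eq_bigr => l _; rewrite /w gramC eqmodC.
rewrite -mulr2n -mulr_natl !mulr_sumr; apply: ler_sum => k _.
rewrite -mulr_suml mulrA; apply: ler_wpM2r; first exact: qsq_ge0.
apply: le_trans (sum_gram_le k F); rewrite /w -mulr_suml -mulr_sumr.
by rewrite mulrC divfK.
Qed.

Lemma sum_atom_coeff_le f F (Y : {fset Z2}) :
  \sum_(n <- Y) \sum_(i < L) \sum_(m : 'I_M * 'I_M) qsq (atom_coeff f F i m n)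
    <= rho * \sum_(k <- F) qsq (f k).
Proof.
pose a (Y : {fset Z2}) :=
  \sum_(n <- Y) \sum_(i < L) \sum_(m : 'I_M * 'I_M) qsq (atom_coeff f F i m n).
have aE : a = (fun Y : {fset Z2} => \sum_(k <- F) \sum_(l <- F)
    (M ^ 2)%:R * (eqmodZ2 M k l)%:R * q_1 (qconj (f k) * f l) *
    \sum_(i < L) \sum_(n <- Y) q_1 (u i (k - n *+ N)) * q_1 (u i (l - n *+ N))).
  apply/funext => Z; rewrite /a.
  under eq_bigr => n _.
    under eq_bigr => i _.
      rewrite sum_qsq_modul //; last by move=> k; exact: (u_l2 i).2.
      over.
    rewrite exchange_big /=.
    under eq_bigr do rewrite exchange_big /=.
    over.
  rewrite exchange_big /=; apply: eq_bigr => k _.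
  rewrite exchange_big /=; apply: eq_bigr => l _.
  under eq_bigr do rewrite -mulr_sumr.
  by rewrite -mulr_sumr exchange_big.
have acvg : a @ totally --> \sum_(k <- F) \sum_(l <- F)
    (M ^ 2)%:R * (eqmodZ2 M k l)%:R * q_1 (qconj (f k) * f l) * gram k l.
  rewrite aE; apply: cvg_big => [|k _]; first exact: add_continuous.
  apply: cvg_big => [|l _]; first exact: add_continuous.
  apply: cvgMl_tmp; apply: cvg_big => [|i _]; first exact: add_continuous.
  exact/cvg_rsum/abs_summable_gram.
rewrite -/(a Y); apply: le_trans (gram_form_le f F).
(* The sums [a] increase with the set of translations and converge to the quadratic form of [gram],
   so the value at Y lies below the limit. *)
apply: (cvgr_to_ge acvg); apply: filterS (totally_superset Y) => Z YZ.
apply: le_sum_fset => // n.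
by apply: sumr_ge0 => i _; apply: sumr_ge0 => m _; exact: qsq_ge0.
Qed.

(** Moving the finite sums inside leaves a single unordered sum of nonnegative reals, the shape
    required by [esum_le] and [minkowski_esum]. *)
Lemma gabor_sumE (v : 'I_L -> Z2 -> quat R) f : gabor_sum M N v f =
  (\esum_(n in [set: Z2]) (\sum_(i < L) \sum_(m : 'I_M * 'I_M)
    qsq (inner (modul m (trans N n (v i))) f))%:E)%E.
Proof.
rewrite /gabor_sum -esum_sum; last first.
  by move=> n i _ _; apply: sume_ge0 => m _; rewrite lee_fin sqr_ge0.
apply: eq_esum => n _; rewrite -sumEFin; apply: eq_bigr => i _.
by rewrite -sumEFin; apply: eq_bigr => m _; rewrite sqr_qnorm.
Qed.

Lemma gabor_bessel f (s : R) : sqnorm f = s%:E ->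
  (gabor_sum M N u f <= (rho * s)%:E)%E.
Proof.
move=> fs; have fl2 : l2 f by rewrite /l2 fs ltry.
rewrite gabor_sumE; apply: esum_le => Y.
have cv : (fun F => \sum_(n <- Y) \sum_(i < L) \sum_(m : 'I_M * 'I_M)
    qsq (atom_coeff f F i m n)) @ totally --> \sum_(n <- Y) \sum_(i < L)
    \sum_(m : 'I_M * 'I_M) qsq (inner (modul m (trans N n (u i))) f).
  do 3 (apply: cvg_big => [|? _]; first exact: add_continuous).
  by apply: cvg_qsq_inner => //; apply: l2_atom; exact: (u_l2 _).1.
(* With Y fixed, the bound holds for every truncation F and is uniform in F, hence passes to the
   limit. *)
apply: (cvgr_to_le cv); apply: nearW => F.
apply: (le_trans (sum_atom_coeff_le f F Y)).
rewrite ler_wpM2l ?rho_ge0 // -lee_fin -fs sqnormE.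
by apply: sum_fset_le_esum => k; exact: qsq_ge0.
Qed.

End GaborBessel.

(** * Transfer of the frame bounds by Minkowski's inequality *)

Section GaborPerturbation.
Variables (R : realType) (L M N : nat).
Implicit Types (u v : 'I_L -> Z2 -> quat R) (f : Z2 -> quat R).

Lemma gabor_pertN u : gabor_pert M N (fun l k => - u l k) = gabor_pert M N u.
Proof.
congr (_ * _)%E; apply: eq_bigr => r _; apply: eq_esum => p _.
congr (qnorm _)%:E; apply: eq_bigr => l _; congr qsum.
by apply/funext => n; rewrite /gmat /Zmat_tr mulrNN.
Qed.

Lemma gabor_sum_ge0 u f : (0 <= gabor_sum M N u f)%E.
Proof.
rewrite gabor_sumE; apply: esum_ge0 => n _; rewrite lee_fin.
by apply: sumr_ge0 => i _; apply: sumr_ge0 => m _; exact: qsq_ge0.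
Qed.

(** Atoms, and hence coefficients, are additive in the generators, so [qsqD_le] can be summed over i
    and m for each t. *)
Lemma gabor_minkowski u v f (al be : R) :
  (forall l, l2 (u l)) -> (forall l, l2 (v l)) -> l2 f ->
  0 <= al -> 0 <= be ->
  (gabor_sum M N u f <= al%:E)%E -> (gabor_sum M N v f <= be%:E)%E ->
  (gabor_sum M N (fun l k => u l k + v l k)%R f
     <= ((Num.sqrt al + Num.sqrt be) ^+ 2)%:E)%E.
Proof.
move=> ul2 vl2 fl2 al0 be0; rewrite !gabor_sumE; apply: minkowski_esum => //.
- by move=> n; apply: sumr_ge0 => i _; apply: sumr_ge0 => m _; exact: qsq_ge0.
- by move=> n; apply: sumr_ge0 => i _; apply: sumr_ge0 => m _; exact: qsq_ge0.
move=> t t0 n; rewrite !mulr_sumr -big_split; apply: ler_sum => i _ /=.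
rewrite !mulr_sumr -big_split; apply: ler_sum => m _ /=.
have -> : modul m (trans N n (fun k => u i k + v i k)) =
    (fun k => modul m (trans N n (u i)) k + modul m (trans N n (v i)) k).
  by apply/funext => k; rewrite /modul /trans mulrDr mulrDl.
by rewrite innerD //; [exact: qsqD_le|exact: l2_atom..].
Qed.

End GaborPerturbation.

(* [rho] is the quantity R of the informal statement. *)
Theorem theorem8 (R : realType) (L M N : nat)
  (L_gt0 : (0 < L)%N) (M_gt0 : (0 < M)%N) (N_gt0 : (0 < N)%N)
  (g h : 'I_L -> Z2 -> quat R)
  (g_l2 : forall l, l2_real (g l)) (h_l2 : forall l, l2_real (h l))
  (A B : R) (g_frame : gabor_frame M N g A B)
  (rho : R) (rhoE : rho%:E = gabor_pert M N (fun l k => g l k - h l k))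
  (rho_lt : rho < A) :
  gabor_frame M N h
    (A * (1 - Num.sqrt (rho / A)) ^+ 2)
    (B * (1 + Num.sqrt (rho / B)) ^+ 2).
Proof.
(* The upper bound uses h = g + u' and the lower bound g = h + u. Both perturbations have Bessel
   bound [rho]. *)
pose u l k := g l k - h l k; pose u' l k := - u l k.
have u_l2 l : l2_real (u l) by exact: l2_realD (g_l2 l) (l2_realN (h_l2 l)).
have u'_l2 l : l2_real (u' l) by exact: l2_realN.
have u_pert : (gabor_pert M N u <= rho%:E)%E by rewrite rhoE.
have u'_pert : (gabor_pert M N u' <= rho%:E)%E by rewrite gabor_pertN.
have rho0 : 0 <= rho by exact: rho_ge0 u_pert.
have [A0 AB gAB] := g_frame.
have B0 : 0 < B by exact: lt_le_trans AB.
pose a := Num.sqrt A; pose b := Num.sqrt B; pose r := Num.sqrt rho.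
have aE : A = a ^+ 2 by rewrite sqr_sqrtr // ltW.
have bE : B = b ^+ 2 by rewrite sqr_sqrtr // ltW.
have a0 : 0 < a by rewrite sqrtr_gt0.
have b0 : 0 < b by rewrite sqrtr_gt0.
have r0 : 0 <= r by exact: sqrtr_ge0.
have ra : r < a by rewrite ltr_sqrt.
have lowE : A * (1 - Num.sqrt (rho / A)) ^+ 2 = (a - r) ^+ 2.
  rewrite sqrtrM // sqrtrV ?ltW // -/a -/r aE; field; exact: lt0r_neq0.
have upE : B * (1 + Num.sqrt (rho / B)) ^+ 2 = (b + r) ^+ 2.
  rewrite sqrtrM // sqrtrV ?ltW // -/b -/r bE; field; exact: lt0r_neq0.
rewrite lowE upE; split.
- by rewrite exprn_gt0 // subr_gt0.
- have ab : a <= b by rewrite ler_sqrt // ltW.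
  by apply: lerXn2r; rewrite ?nnegrE; lra.
move=> f fl2; have [gA gB] := gAB f fl2.
have s_ge0 : (0 <= sqnorm f)%E.
  by apply: esum_ge0 => k _; rewrite lee_fin sqr_ge0.
have [s fs] : exists s, sqnorm f = s%:E.
  by exists (fine (sqnorm f)); rewrite fineK // ge0_fin_numE.
rewrite fs in gA gB s_ge0 *; rewrite lee_fin in s_ge0.
have ubess := gabor_bessel M_gt0 N_gt0 u_l2 u_pert fs.
have u'bess := gabor_bessel M_gt0 N_gt0 u'_l2 u'_pert fs.
pose t := Num.sqrt s; have t0 : 0 <= t by exact: sqrtr_ge0.
have sE : s = t ^+ 2 by rewrite sqr_sqrtr.
have up : (gabor_sum M N h f <= ((b + r) ^+ 2)%:E * s%:E)%E.
  have -> : h = (fun l k => g l k + u' l k).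
    by apply/funext => l; apply/funext => k; rewrite /u' /u opprB addrC subrK.
  have -> : (((b + r) ^+ 2)%:E * s%:E)%E =
      ((Num.sqrt (B * s) + Num.sqrt (rho * s)) ^+ 2)%:E.
    rewrite -EFinM (sqrtrM _ (ltW B0)) (sqrtrM _ rho0) -/t.
    by rewrite -mulrDl exprMn -sE.
  apply: gabor_minkowski => //; rewrite ?mulr_ge0 // ?ltW //.
  - by move=> l; exact: (g_l2 l).1.
  - by move=> l; exact: (u'_l2 l).1.
split=> //.
(* The upper bound makes this sum finite, so its square root can be handled in the reals. *)
have [x hx] : exists x, gabor_sum M N h f = x%:E.
  exists (fine (gabor_sum M N h f)); rewrite fineK // ge0_fin_numE.
    by apply: le_lt_trans up _; rewrite -EFinM ltry.
  exact: gabor_sum_ge0.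
have x0 : 0 <= x by rewrite -lee_fin -hx gabor_sum_ge0.
rewrite hx -EFinM lee_fin sE -exprMn.
have : (gabor_sum M N g f
    <= ((Num.sqrt x + Num.sqrt (rho * s)) ^+ 2)%:E)%E.
  have -> : g = (fun l k => h l k + u l k).
    by apply/funext => l; apply/funext => k; rewrite /u addrC subrK.
  apply: gabor_minkowski => //; rewrite ?mulr_ge0 // ?hx //.
  - by move=> l; exact: (h_l2 l).1.
  - by move=> l; exact: (u_l2 l).1.
move=> /(le_trans gA); rewrite -EFinM lee_fin aE sE -exprMn.
rewrite sqrtrM // -sE -/t -/r.
have at0 : 0 <= a * t by rewrite mulr_ge0 // ltW.
have xrt0 : 0 <= Num.sqrt x + r * t by rewrite addr_ge0 ?mulr_ge0 ?sqrtr_ge0.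
(* Taking roots gives a t <= sqrt x + r t. Squaring (a - r) t <= sqrt x then preserves the order
   because r < a. *)
rewrite ler_pXn2r ?nnegrE // => le_at; rewrite -[leRHS](sqr_sqrtr x0).
apply: lerXn2r; rewrite ?nnegrE ?sqrtr_ge0 //.
  by rewrite mulr_ge0 // subr_ge0 ltW.
by rewrite mulrBl lerBlDr.
Qed.
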